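(* Let $(\bar x,\bar y)$ be a local solution to the minimax problem $\min_{x\in X}\max_{y\in\mathcal F(x)}f(x,y)$. Suppose that $f(x,y)$ is jointly concave and (each component of) $g(x,y)$ is jointly quasiconvex in $(x,y)$, and that there is an open set $\mathcal O\ni\bar x$ such that, for every $x\in\mathcal O$, $\mathcal F(x)$ is nonempty and $f(x,\cdot)$ is bounded above on $\mathcal F(x)$. Assume further that a CQ holds for $g(x,y)\le0$ (in the variables $(x,y)$) at $(\bar x,\bar y)$. Then there exists $\bar\lambda$ such that $$0\in\nabla_x\mathcal L(\bar x,\bar y,\bar\lambda)+\mathcal N_X(\bar x),\quad\nabla_y\mathcal L(\bar x,\bar y,\bar\lambda)=0,\quad0\le-g(\bar x,\bar y)\perp\bar\lambda\ge0.$$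
   Context: $f:\mathbb R^{n+m}\to\mathbb R$ and $g:\mathbb R^{n+m}\to\mathbb R^q$ are continuously differentiable, $X\subseteq\mathbb R^n$ is closed. $\mathcal F(x)=\{y\in\mathbb R^m:g(x,y)\le0\}$, $V(x)=\sup\{f(x,y):y\in\mathcal F(x)\}$ ($=-\infty$ if $\mathcal F(x)=\emptyset$), $\mathcal S(x)=\{y\in\mathcal F(x):f(x,y)=V(x)\}$. $(\bar x,\bar y)$ is a local solution of the minimax problem (in the sense of Stackelberg) if $\bar x\in X$ is a local minimizer of $V$ over $X$ and $\bar y\in\mathcal S(\bar x)$. $\mathcal L(x,y,\lambda)=f(x,y)-g(x,y)^\top\lambda$; $\nabla$ of a vector-valued map is the transposed Jacobian. A constraint qualification (CQ) at a feasible point $\bar z$ of a system $G(z)\le0$ ($G$ continuously differentiable) is a condition on the system ensuring that whenever $\bar z$ is a local minimizer over the feasible set of a continuously differentiable function $\varphi$, the KKT conditions hold: there is $a\ge0$ with $a\perp G(\bar z)$ and $\nabla\varphi(\bar z)+\nabla G(\bar z)a=0$. $\mathcal N_X(\bar x)$ is the limiting normal cone: limits of $\xi^k\in\widehat{\mathcal N}_X(x^k)$ with $x^k\to\bar x$, $x^k\in X$, where $\widehat{\mathcal N}_X(x^* )=\{\xi:\xi^\top(x-x^* )\le o(\|x-x^*\|)\ \forall x\in X\}$. *)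

(* Defs.v *)
From HB Require Import structures.
From mathcomp Require Import all_boot all_order all_algebra.
From mathcomp Require Import all_classical all_reals all_analysis.

Set Implicit Arguments.
Unset Strict Implicit.
Unset Printing Implicit Defensive.
Import Order.TTheory GRing.Theory Num.Theory.
Import numFieldNormedType.Exports.

Local Open Scope classical_set_scope.
Local Open Scope ring_scope.
Local Open Scope convex_scope.

(* Vectors are row vectors, as in the library's Jacobian 'J, and a point (x, y)
   of R^n x R^m is row_mx x y. The norm on 'rV[R]_N is the max norm; only
   notions that do not depend on the choice of a norm are used. *)

Definition dot (R : realType) (N : nat) (u v : 'rV[R]_N) : R :=
  (u *m v^T) 0 0.

(* For a finite-dimensional source, continuity of z |-> 'd f z v for each v is
   the same as continuity of z |-> 'd f z. *)
Definition C1 (R : realType) (N : nat) (W : normedModType R)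
    (f : 'rV[R]_N -> W) : Prop :=
  (forall z, differentiable f z) /\
  (forall v : 'rV[R]_N, continuous (fun z => 'd f z v)).

Definition grad (R : realType) (N : nat) (f : 'rV[R]_N -> R) (z : 'rV[R]_N) :
    'rV[R]_N :=
  \row_j 'D_(delta_mx 0 j) f z.

Definition local_minimizer (R : realType) (N : nat) (d : Order.disp_t)
    (T : porderType d) (D : set 'rV[R]_N) (F : 'rV[R]_N -> T)
    (z : 'rV[R]_N) : Prop :=
  D z /\ \forall w \near z, D w -> (F z <= F w)%O.

Definition concave_function (R : realType) (E : lmodType R) (f : E -> R) :
    Prop :=
  @convex_function R E setT (fun z => - f z).

Definition quasiconvex_function (R : realType) (E : lmodType R) (f : E -> R) :
    Prop :=
  forall (t : {i01 R}) (x y : convex_lmodType E),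
    f (x <| t |> y) <= Num.max (f x) (f y).

Definition feasible_set (R : realType) (N q : nat) (G : 'rV[R]_N -> 'rV[R]_q) :
    set 'rV[R]_N :=
  [set z | forall i, G z 0 i <= 0].

(* 'J G z is the N x q matrix whose j-th column is the gradient of the j-th
   component of G, i.e. the transposed Jacobian in the column convention;
   a *m ('J G z)^T is thus the row vector of the linear combination of these
   gradients with coefficients a. *)
Definition KKT (R : realType) (N q : nat) (G : 'rV[R]_N -> 'rV[R]_q)
    (phi : 'rV[R]_N -> R) (z : 'rV[R]_N) : Prop :=
  exists a : 'rV[R]_q,
    [/\ forall i, 0 <= a 0 i,
        dot a (G z) = 0 &
        grad phi z + a *m ('J G z)^T = 0].

(* Q is a condition on a system G <= 0 and a point of it. *)
Definition is_constraint_qualification (R : realType) (N q : nat)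
    (Q : ('rV[R]_N -> 'rV[R]_q) -> 'rV[R]_N -> Prop) : Prop :=
  forall (G : 'rV[R]_N -> 'rV[R]_q) (z : 'rV[R]_N),
    C1 G -> feasible_set G z -> Q G z ->
    forall phi : 'rV[R]_N -> R, C1 phi ->
      local_minimizer (feasible_set G) phi z -> KKT G phi z.

Definition frechet_normal_cone (R : realType) (N : nat) (X : set 'rV[R]_N)
    (z : 'rV[R]_N) : set 'rV[R]_N :=
  [set xi | exists h : 'rV[R]_N -> R,
     h =o_z (fun x => `|x - z|) /\
     forall x, X x -> dot xi (x - z) <= h x].

Definition limiting_normal_cone (R : realType) (N : nat) (X : set 'rV[R]_N)
    (z : 'rV[R]_N) : set 'rV[R]_N :=
  [set xi | exists (zk xik : nat -> 'rV[R]_N),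
     [/\ forall k, X (zk k),
         forall k, frechet_normal_cone X (zk k) (xik k),
         zk @ \oo --> z &
         xik @ \oo --> xi]].

Section minimax.
Context (R : realType) (n m q : nat).
Variables (f : 'rV[R]_(n + m) -> R) (g : 'rV[R]_(n + m) -> 'rV[R]_q).

Definition lower_feasible (x : 'rV[R]_n) : set 'rV[R]_m :=
  [set y | feasible_set g (row_mx x y)].

Definition value_function (x : 'rV[R]_n) : \bar R :=
  ereal_sup [set (f (row_mx x y))%:E | y in lower_feasible x].

Definition lower_solutions (x : 'rV[R]_n) : set 'rV[R]_m :=
  [set y | lower_feasible x y /\ (f (row_mx x y))%:E = value_function x].

Definition local_minimax_solution (X : set 'rV[R]_n) (x : 'rV[R]_n)
    (y : 'rV[R]_m) : Prop :=
  local_minimizer X value_function x /\ lower_solutions x y.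

Definition lagrangian (x : 'rV[R]_n) (y : 'rV[R]_m) (lam : 'rV[R]_q) : R :=
  f (row_mx x y) - dot (g (row_mx x y)) lam.

End minimax.

(* Main.v *)
Require Import Defs.
From HB Require Import structures.
From mathcomp Require Import all_boot all_order all_algebra.
From mathcomp Require Import all_classical all_reals all_analysis.
From mathcomp Require Import lra.

Set Implicit Arguments.
Unset Strict Implicit.
Unset Printing Implicit Defensive.
Import Order.TTheory GRing.Theory Num.Theory.
Import numFieldNormedType.Exports.

Local Open Scope classical_set_scope.
Local Open Scope ring_scope.

(** The KKT system of the theorem is that of an ordinary nonlinear program in
    the joint variable z = (x, y), whose objective is f tilted by a linear form
    in x.  Joint concavity of f and joint quasiconvexity of g make the set of
    pairs (w, r) such that r <= f (xbar + w, y) - f (xbar, ybar) for some y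
    feasible at xbar + w a convex set: it is the hypograph of the concave
    function V (xbar + _) - V xbar, up to attainment of the supremum.  Since the
    lower-level problem is feasible for every x near xbar, the projection of
    this set on the w-space is a neighborhood of 0, so the set is supported at
    the origin by a non-vertical hyperplane (supporting_slope).  Its slope xi
    is a supergradient of V at xbar:
      f (x, y) <= f (xbar, ybar) + xi . (x - xbar) for all feasible (x, y)
    (value_supergradient).

    This single inequality is used twice.  Read over the pairs (x, y), it says
    that (xbar, ybar) minimizes the C1 function (x, y) |-> xi . x - f (x, y)
    over g <= 0; the constraint qualification then provides a multiplier lam
    for which the gradient of f - g . lam at (xbar, ybar) is (xi, 0).  Read
    after taking the supremum in y, it bounds V x by V xbar + xi . (x - xbar);
    as xbar minimizes V over X locally, xi . (x - xbar) >= 0 for all x in X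
    near xbar, hence - xi is a Frechet normal to X at xbar. *)

(** * The dot product and its derivatives *)

Section dot_product.
Context (R : realType) (n : nat).
Implicit Types u v w : 'rV[R]_n.

Lemma dotE u v : dot u v = \sum_i u 0 i * v 0 i.
Proof. by rewrite /dot mxE; apply: eq_bigr => i _; rewrite mxE. Qed.

Lemma dotC u v : dot u v = dot v u.
Proof. by rewrite !dotE; apply: eq_bigr => i _; rewrite mulrC. Qed.

Fact dot_is_linear u : linear (dot u : 'rV[R]_n -> R^o).
Proof.
by move=> a v w; rewrite /dot linearP mulmxDr -scalemxAr !mxE.
Qed.

HB.instance Definition _ u :=
  GRing.isLinear.Build R 'rV[R]_n R^o *:%R (dot u) (dot_is_linear u).

Lemma dot0l v : dot 0 v = 0.
Proof. by rewrite /dot mul0mx mxE. Qed.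

Lemma dotDl u v w : dot (u + v) w = dot u w + dot v w.
Proof. by rewrite /dot mulmxDl mxE. Qed.

Lemma dotNl u v : dot (- u) v = - dot u v.
Proof. by rewrite /dot mulNmx mxE. Qed.

Lemma dotDr u v w : dot u (v + w) = dot u v + dot u w.
Proof. exact: (linearD (dot u)). Qed.

Lemma dotZr a u v : dot u (a *: v) = a * dot u v.
Proof. by rewrite /dot linearZ -scalemxAr mxE. Qed.

Lemma dotZl a u v : dot (a *: u) v = a * dot u v.
Proof. by rewrite /dot -scalemxAl mxE. Qed.

Lemma dot_delta v i : dot (delta_mx 0 i) v = v 0 i.
Proof.
rewrite dotE (bigD1 i)//= big1 => [|j ji]; first by rewrite mxE !eqxx mul1r addr0.
by rewrite mxE (negPf ji) andbF mul0r.
Qed.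

Lemma dot_row_mx k u v (u' v' : 'rV[R]_k) :
  dot (row_mx u u') (row_mx v v') = dot u v + dot u' v'.
Proof. by rewrite /dot tr_row_mx mul_row_col mxE. Qed.

Lemma differentiable_dot u z : differentiable (dot u) z.
Proof.
have -> : dot u = \sum_i (fun v => v 0 i * u 0 i) :> ('rV[R]_n -> R).
  by apply/funext => v; rewrite fct_sumE dotC dotE.
apply: differentiable_sum => i.
apply: differentiableM; last exact: differentiable_cst.
exact: differentiable_coord.
Qed.

Lemma derive_dot u z v : 'D_v (dot u) z = dot u v.
Proof.
rewrite deriveE; last exact: differentiable_dot.
rewrite (@diff_lin _ _ _ (dot u : {linear 'rV[R]_n -> R^o}) z)//.
by move=> x; apply: differentiable_continuous; apply: differentiable_dot.
Qed.

End dot_product.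

Lemma derive_dotr (R : realType) (N q : nat) (g : 'rV[R]_N -> 'rV[R]_q)
    (a : 'rV[R]_q) (z v : 'rV[R]_N) : differentiable g z ->
  is_derive z v (fun w => dot (g w) a) (dot (v *m 'J g z) a).
Proof.
move=> dg; have -> : (fun w => dot (g w) a) = dot a \o g.
  by apply/funext => w; rewrite dotC.
have dd := differentiable_dot a (g z).
have dc : differentiable (dot a \o g) z by exact: differentiable_comp.
split; first exact: diff_derivable.
by rewrite deriveE// diff_comp//= -!deriveE// derive_dot deriveEjacobian// dotC.
Qed.

Lemma grad_dot_comp (R : realType) (N q : nat) (f : 'rV[R]_N -> R)
    (g : 'rV[R]_N -> 'rV[R]_q) (a : 'rV[R]_q) (z : 'rV[R]_N) :
  differentiable f z -> differentiable g z ->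
  grad (fun w => f w - dot (g w) a) z = grad f z - a *m ('J g z)^T.
Proof.
move=> df dg; apply/rowP => j; rewrite !mxE.
have dfj := @diff_derivable _ _ _ f z (delta_mx 0 j) df.
have dgj := @derive_dotr _ _ _ g a z (delta_mx 0 j) dg.
rewrite (deriveB dfj (@ex_derive _ _ _ _ _ _ _ dgj)).
rewrite (@derive_val _ _ _ _ _ _ _ dgj) -rowE dotE; congr (_ - _).
by apply: eq_bigr => i _; rewrite !mxE mulrC.
Qed.

Lemma derive_dotB (R : realType) (N : nat) (f : 'rV[R]_N -> R)
    (u z v : 'rV[R]_N) :
  differentiable f z -> 'D_v (fun w => dot u w - f w) z = dot u v - 'D_v f z.
Proof.
move=> df; rewrite -(derive_dot u z); apply: deriveB.
  apply: diff_derivable; exact: differentiable_dot.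
exact: diff_derivable.
Qed.

Lemma grad_dotB (R : realType) (N : nat) (f : 'rV[R]_N -> R) (u z : 'rV[R]_N) :
  differentiable f z -> grad (fun w => dot u w - f w) z = u - grad f z.
Proof.
by move=> df; apply/rowP => j; rewrite !mxE derive_dotB// dotC dot_delta.
Qed.

Lemma C1_dotB (R : realType) (N : nat) (f : 'rV[R]_N -> R) (u : 'rV[R]_N) :
  C1 f -> C1 (fun w => dot u w - f w).
Proof.
move=> [df cf].
have dB z : differentiable (fun w => dot u w - f w) z.
  exact: (differentiableB (differentiable_dot u z) (df z)).
split => // v.
pose p (z : 'rV[R]_N) : R := 'd f z v; have cp : continuous p by exact: cf.
have -> : (fun z => 'd (fun w => dot u w - f w) z v) = (fun z => dot u v - p z).
  by apply/funext => z; rewrite /p -!deriveE// derive_dotB.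
move=> z; apply: (@cvgB R R^o _ (nbhs z) _ (fun=> dot u v) p); last exact: cp.
exact: cvg_cst.
Qed.

(** * Supporting a convex set by a non-vertical hyperplane *)

(** Normalizing positive weights turns every conic combination into a convex
    one; this form spares the slope computations below from fractions. *)
Lemma convex_set_conic (R : realType) (E : lmodType R)
    (A : set (convex_lmodType E)) (s t : R) (x y : E) :
  convex_set A -> 0 < s -> 0 < t -> A x -> A y ->
  A ((s + t)^-1 *: (s *: x + t *: y)).
Proof.
move=> cA s0 t0 Ax Ay; have st0 : 0 < s + t by rewrite addr_gt0.
have p0 : 0 <= s / (s + t) by rewrite divr_ge0 ?ltW.
have p1 : s / (s + t) <= 1 by rewrite ler_pdivrMr// mul1r lerDl ltW.
have := cA x y (Itv01 p0 p1); rewrite !inE => /(_ Ax Ay).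
congr A.
transitivity ((s / (s + t)) *: x + (1 - s / (s + t)) *: y) => //.
have -> : 1 - s / (s + t) = t / (s + t).
  by rewrite -[X in X - _](divff (lt0r_neq0 st0)) -mulrBl addrAC subrr add0r.
by rewrite scalerDr !scalerA ![_^-1 * _]mulrC.
Qed.

Section supporting_slope.
Context (R : realType) (n : nat).
Variable A : set ('rV[R]_n * R^o).
Hypothesis cA : @convex_set R ('rV[R]_n * R^o)%type A.
Hypothesis A_near : \forall w \near (0 : 'rV[R]_n), exists r, A (w, r).

(** What the neighborhood assumption is used for: in every direction, A has
    points on both sides of the vertical line over the origin. *)
Lemma points_on_both_sides (v : 'rV[R]_n) :
  exists2 t : R, 0 < t & (exists r, A (t *: v, r)) /\ (exists r, A (- t *: v, r)).
Proof.
have cZ (w : 'rV[R]_n) : (fun t : R => t *: w) @ (0 : R) --> (0 : 'rV[R]_n).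
  rewrite -[X in _ --> X](scale0r w); apply: cvgZr_tmp; exact: cvg_id.
have [e1 /= e10 he1] := (nbhs_ballP _ _).1 (cZ v _ A_near).
have [e2 /= e20 he2] := (nbhs_ballP _ _).1 (cZ (- v) _ A_near).
pose t := Num.min e1 e2 / 2.
have m0 : 0 < Num.min e1 e2 by rewrite lt_min e10 e20.
have t0 : 0 < t by rewrite divr_gt0.
have tm : t < Num.min e1 e2 by rewrite ltr_pdivrMr// ltr_pMr// ltr1n.
have {tm}[te1 te2] : t < e1 /\ t < e2 by move: tm; rewrite lt_min => /andP[].
exists t => //; split.
  by apply: he1; rewrite /ball/= sub0r normrN gtr0_norm.
rewrite scaleNr -scalerN.
by apply: he2; rewrite /ball/= sub0r normrN gtr0_norm.
Qed.

(** One Hahn-Banach step: xi dominates A over the vectors supported on the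
    first k coordinates, and a multiple c of the k-th coordinate form is added
    to extend the domination by one dimension.  The points of A with positive
    k-th coordinate bound c from below by the slopes (r - xi . w) / w_k, those
    with negative k-th coordinate bound it from above by the same expression.
    These bounds are compatible because a conic combination that cancels the
    k-th coordinate falls back into the domain of xi. *)
Lemma supporting_slope_extend (k : 'I_n) (xi : 'rV[R]_n) :
  (forall w r, A (w, r) -> (forall j : 'I_n, (k <= j)%N -> w 0 j = 0) ->
     r <= dot xi w) ->
  exists xi' : 'rV[R]_n,
    forall w r, A (w, r) -> (forall j : 'I_n, (k < j)%N -> w 0 j = 0) ->
     r <= dot xi' w.
Proof.
move=> xiP.
pose W (w : 'rV[R]_n) := forall j : 'I_n, (k < j)%N -> w 0 j = 0.
have We t : W (t *: delta_mx 0 k).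
  by move=> j kj; rewrite !mxE (gtn_eqF kj : (j == k) = false) andbF mulr0.
have slopes w r w' r' : A (w, r) -> W w -> 0 < w 0 k ->
    A (w', r') -> W w' -> w' 0 k < 0 ->
    (r - dot xi w) / w 0 k <= (r' - dot xi w') / w' 0 k.
  move=> Aw Ww w0 Aw' Ww' w'0.
  (* the weights cancel the k-th coordinate of s *: w + t *: w' *)
  set t := w 0 k; set s := - w' 0 k.
  have s0 : 0 < s by rewrite oppr_gt0.
  have := convex_set_conic cA s0 w0 Aw Aw'.
  set a := (_ + _ : R)^-1; have a0 : 0 < a by rewrite invr_gt0 addr_gt0.
  move=> /(xiP (a *: (s *: w + t *: w')) (a * (s * r + t * r'))).
  have Wc (j : 'I_n) : (k <= j)%N -> (a *: (s *: w + t *: w')) 0 j = 0.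
    rewrite leq_eqVlt => /predU1P[kj|kj]; last first.
      by rewrite !mxE Ww// Ww'// !mulr0 addr0 mulr0.
    have -> : j = k by apply/val_inj.
    by rewrite !mxE /s /t mulNr [w 0 k * _]mulrC addNr mulr0.
  move=> /(_ Wc); rewrite dotZr ler_pM2l// dotDr !dotZr => h.
  rewrite -[w' 0 k]opprK -/s invrN mulrN -mulNr.
  rewrite ler_pdivrMr// mulrAC ler_pdivlMr// opprB mulrBl mulrBl.
  by rewrite lerBlDr addrAC lerBrDr [r * s]mulrC [r' * t]mulrC
    [dot xi w' * t]mulrC [dot xi w * s]mulrC [leRHS]addrC.
have [t t0 [[r1 Ar1] [r2 Ar2]]] := points_on_both_sides (delta_mx 0 k).
pose S := [set x | exists w r, [/\ A (w, r), W w, 0 < w 0 k &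
                                  x = (r - dot xi w) / w 0 k]].
have tek (a : R) : (a *: delta_mx 0 k : 'rV[R]_n) 0 k = a.
  by rewrite !mxE !eqxx mulr1.
have S_n0 : S !=set0.
  eexists; exists (t *: delta_mx 0 k), r1; split => //.
  by rewrite tek.
have S_ub w r : A (w, r) -> W w -> w 0 k < 0 ->
    ubound S ((r - dot xi w) / w 0 k).
  by move=> Aw Ww w0 _ [w' [r' [? ? ? ->]]]; apply: slopes.
have S_sup : has_sup S.
  split=> //; eexists; apply: (S_ub _ _ Ar2) => //.
  by rewrite tek oppr_lt0.
exists (xi + sup S *: delta_mx 0 k) => w r Aw Ww.
rewrite dotDl dotZl dot_delta -lerBlDl.
have [w0|w0|w0] := ltgtP (w 0 k) 0.
- rewrite -ler_ndivlMr//; apply: ge_sup => //; exact: S_ub.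
- rewrite -ler_pdivrMr//; apply: ub_le_sup; first by case: S_sup.
  by exists w, r.
- rewrite w0 mulr0 subr_le0; apply: xiP => // j.
  rewrite leq_eqVlt => /predU1P[kj|]; last exact: Ww.
  by have -> : j = k by apply/val_inj.
Qed.

(** No point of A lies strictly above the origin, so convexity separates A from
    the open vertical ray over the origin; the neighborhood assumption keeps the
    separating hyperplane from being vertical.  It is the graph of dot xi. *)
Lemma supporting_slope : (forall r, A (0, r) -> r <= 0) ->
  exists xi : 'rV[R]_n, forall w r, A (w, r) -> r <= dot xi w.
Proof.
move=> A0.
have ind k : (k <= n)%N -> exists xi : 'rV[R]_n, forall w r, A (w, r) ->
    (forall j : 'I_n, (k <= j)%N -> w 0 j = 0) -> r <= dot xi w.
  elim: k => [_|k IH kn].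
    exists 0 => w r Aw w0; have w_eq0 : w = 0.
      by apply/rowP => j; rewrite w0// mxE.
    by rewrite w_eq0 dot0l; apply: A0; rewrite -w_eq0.
  have [xi xiP] := IH (ltnW kn).
  exact: (@supporting_slope_extend (Ordinal kn) xi xiP).
have [xi xiP] := ind n (leqnn n).
by exists xi => w r Aw; apply: xiP => // j; rewrite leqNgt ltn_ord.
Qed.

End supporting_slope.

(** * Partial gradients and normal cones *)

Section partial_gradients.
Context (R : realType) (n m : nat).
Variables (F : 'rV[R]_(n + m) -> R) (x : 'rV[R]_n) (y : 'rV[R]_m).

Lemma grad_left :
  grad (fun x => F (row_mx x y)) x = lsubmx (grad F (row_mx x y)).
Proof.
apply/rowP => j; rewrite !mxE /derive.
set a := fun h : R => _; set b := fun h : R => _.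
suff -> : a = b by [].
apply/funext => h; rewrite /a /b/=.
by rewrite delta_mx_lshift scale_row_mx add_row_mx scaler0 add0r.
Qed.

Lemma grad_right :
  grad (fun y => F (row_mx x y)) y = rsubmx (grad F (row_mx x y)).
Proof.
apply/rowP => j; rewrite !mxE /derive.
set a := fun h : R => _; set b := fun h : R => _.
suff -> : a = b by [].
apply/funext => h; rewrite /a /b/=.
by rewrite delta_mx_rshift scale_row_mx add_row_mx scaler0 add0r.
Qed.

End partial_gradients.

(** The remainder h in the definition of a Frechet normal is asked to dominate
    xi . (x - z) on all of X; the positive part of that linear form on X is a
    remainder, because it vanishes near z. *)
Lemma frechet_normal_near (R : realType) (N : nat) (X : set 'rV[R]_N)
    (z xi : 'rV[R]_N) :
  (\forall x \near z, X x -> dot xi (x - z) <= 0) ->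
  frechet_normal_cone X z xi.
Proof.
move=> xile0.
pose h (x : 'rV[R]_N) : R := if `[< X x >] then Num.max 0 (dot xi (x - z)) else 0.
exists h; split => [|x Xx]; last first.
  by rewrite /h asboolT// le_max lexx orbT.
apply/eqoP => e e0; near=> x.
have xle : X x -> dot xi (x - z) <= 0 by near: x.
have -> : h x = 0 by rewrite /h; case: asboolP => // /xle; exact: max_l.
by rewrite normr0 mulr_ge0// ltW.
Unshelve. all: by end_near. Qed.

Lemma frechet_limiting (R : realType) (N : nat) (X : set 'rV[R]_N)
    (z xi : 'rV[R]_N) :
  X z -> frechet_normal_cone X z xi -> limiting_normal_cone X z xi.
Proof.
by move=> Xz xiz; exists (fun=> z), (fun=> xi); split => //; exact: cvg_cst.
Qed.

(** * The value function *)

Lemma feasible_set_convex (R : realType) (N q : nat)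
    (g : 'rV[R]_N -> 'rV[R]_q) :
  (forall i, quasiconvex_function (fun z => g z 0 i)) ->
  convex_set (feasible_set g).
Proof.
move=> gqc x y t; rewrite !inE => gx gy i.
by apply: le_trans (gqc i t x y) _; rewrite ge_max gx gy.
Qed.

(** Stated on the feasible pairs (x, y) instead of on the value function,
    whose values need not be finite away from xbar. *)
Lemma value_supergradient (R : realType) (n m q : nat)
    (f : 'rV[R]_(n + m) -> R) (g : 'rV[R]_(n + m) -> 'rV[R]_q)
    (xbar : 'rV[R]_n) (c : R) :
  concave_function f ->
  (forall i, quasiconvex_function (fun z => g z 0 i)) ->
  (\forall w \near (0 : 'rV[R]_n), lower_feasible g (xbar + w) !=set0) ->
  (forall y, lower_feasible g xbar y -> f (row_mx xbar y) <= c) ->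
  exists xi : 'rV[R]_n, forall x y, lower_feasible g x y ->
    f (row_mx x y) <= c + dot xi (x - xbar).
Proof.
move=> fconc gqc Fnear fc.
pose A : set ('rV[R]_n * R^o) := [set wr | exists2 y,
  lower_feasible g (xbar + wr.1) y &
  wr.2 <= f (row_mx (xbar + wr.1) y) - c].
have cA : @convex_set R ('rV[R]_n * R^o)%type A.
  move=> [w r] [w' r'] t; rewrite !inE => -[y /= Fy ry] [y' /= Fy' ry'].
  set p : R := t%:num; set z := row_mx (xbar + w) y.
  set z' := row_mx (xbar + w') y'.
  have cz : row_mx (xbar + (p *: w + (1 - p) *: w')) (p *: y + (1 - p) *: y') =
      p *: z + (1 - p) *: z'.
    rewrite !scale_row_mx add_row_mx !scalerDr addrACA -scalerDl.
    by rewrite subrKC scale1r.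
  exists (p *: y + (1 - p) *: y').
    have := feasible_set_convex gqc t (mem_set Fy) (mem_set Fy').
    by rewrite inE /lower_feasible /= cz.
  have /= := fconc t z z'; rewrite !in_setT => /(_ isT isT).
  rewrite [leRHS]convRE -/p -[conv _ _ _]/(p *: z + (1 - p) *: z').
  have p0 : 0 <= p by rewrite /p.
  have p1 : 0 <= 1 - p by rewrite subr_ge0 /p.
  have := ler_wpM2l p0 ry; have := ler_wpM2l p1 ry'.
  rewrite /= -[unstable.onem p]/(1 - p) cz -/z -/z'.
  rewrite -[p *: r]/(p * r) -[_ *: r']/((1 - p) * r').
  by move: (f _) (f _) (f _) => a b d; lra.
have A_near : \forall w \near (0 : 'rV[R]_n), exists r, A (w, r).
  apply: filterS Fnear => w [y Fy].
  by exists (f (row_mx (xbar + w) y) - c); exists y.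
have A0 r : A (0, r) -> r <= 0.
  move=> [y]; rewrite /= addr0 => Fy /le_trans; apply.
  by rewrite subr_le0; exact: fc.
have [xi xiP] := supporting_slope cA A_near A0.
exists xi => x y Fxy; rewrite -lerBlDl; apply: xiP.
by exists y; rewrite /= subrKC.
Qed.

Theorem theorem4p8 (R : realType) (n m q : nat)
    (f : 'rV[R]_(n + m) -> R) (g : 'rV[R]_(n + m) -> 'rV[R]_q)
    (X : set 'rV[R]_n) (xbar : 'rV[R]_n) (ybar : 'rV[R]_m)
    (hf : C1 f) (hg : C1 g) (hX : closed X)
    (hsol : local_minimax_solution f g X xbar ybar)
    (hfconc : concave_function f)
    (hgqc : forall i : 'I_q, quasiconvex_function (fun z => g z 0 i))
    (hO : exists O : set 'rV[R]_n,
       [/\ open O, O xbar &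
           forall x, O x ->
             lower_feasible g x !=set0 /\
             has_ubound [set f (row_mx x y) | y in lower_feasible g x]])
    (Q : ('rV[R]_(n + m) -> 'rV[R]_q) -> 'rV[R]_(n + m) -> Prop)
    (hQ : is_constraint_qualification Q)
    (hCQ : Q g (row_mx xbar ybar)) :
  exists lam : 'rV[R]_q,
    [/\ [set grad (fun x => lagrangian f g x ybar lam) xbar + xi
           | xi in limiting_normal_cone X xbar] 0,
        grad (fun y => lagrangian f g xbar y lam) ybar = 0,
        forall i, 0 <= - g (row_mx xbar ybar) 0 i,
        forall i, 0 <= lam 0 i &
        dot (- g (row_mx xbar ybar)) lam = 0].
Proof.
case: hsol => -[Xxbar Vmin] [ybarF ybarV].
set zbar := row_mx xbar ybar in hCQ *; set fbar := f zbar in ybarV.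
have Fnear : \forall w \near (0 : 'rV[R]_n), lower_feasible g (xbar + w) !=set0.
  have [U [oU Uxbar UF]] := hO.
  have cw : (fun w : 'rV[R]_n => xbar + w) @ (0 : 'rV[R]_n) --> xbar.
    rewrite -[X in _ --> X]addr0.
    apply: (@cvgD R 'rV[R]_n _ (nbhs 0) _ (fun=> xbar) id); last exact: cvg_id.
    exact: cvg_cst.
  have nU : nbhs xbar U by apply: open_nbhs_nbhs.
  have nUw : \forall w \near (0 : 'rV[R]_n), U (xbar + w) by exact: (cw U nU).
  by near=> w; have [] // := UF (xbar + w) _; near: w.
have Vbar y : lower_feasible g xbar y -> f (row_mx xbar y) <= fbar.
  move=> Fy; rewrite -lee_fin ybarV.
  by apply: ereal_sup_ubound; exists y.
have [xi xiP] := value_supergradient hfconc hgqc Fnear Vbar.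
have V_le x : (value_function f g x <= (fbar + dot xi (x - xbar))%:E)%E.
  by apply: ge_ereal_sup => _ [y Fy <-]; rewrite lee_fin; exact: xiP.
pose phi z := dot (row_mx xi 0) z - f z.
have phimin : local_minimizer (feasible_set g) phi zbar.
  split => //; near=> z => Fz.
  have := xiP (lsubmx z) (rsubmx z); rewrite /lower_feasible/= hsubmxK => /(_ Fz).
  rewrite /phi -[in dot _ z](hsubmxK z) !dot_row_mx dotDr.
  rewrite -[- xbar]scaleN1r dotZr -/fbar.
  rewrite !dot0l; lra.
have [lam [lam0 lamg lamL]] := hQ _ _ hg ybarF hCQ _ (C1_dotB _ hf) phimin.
have dL : grad (fun z => f z - dot (g z) lam) zbar = row_mx xi 0.
  rewrite grad_dot_comp; [|exact: hf.1|exact: hg.1].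
  move: lamL; rewrite (grad_dotB _ (hf.1 zbar)) -addrA => /eqP.
  by rewrite addr_eq0 opprD opprK => /eqP ->.
exists lam; split => //.
- exists (- xi); last first.
    rewrite (grad_left (fun z => f z - dot (g z) lam)) dL.
    by rewrite row_mxKl subrr.
  apply: frechet_limiting => //; apply: frechet_normal_near.
  apply: filterS Vmin => x xmin Xx.
  rewrite dotNl oppr_le0.
  have := le_trans (xmin Xx) (V_le x).
  by rewrite -ybarV lee_fin lerDl.
- by rewrite (grad_right (fun z => f z - dot (g z) lam)) dL row_mxKr.
- by move=> i; rewrite oppr_ge0.
- by rewrite dotNl dotC lamg oppr0.
Unshelve. all: by end_near. Qed.
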